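(* There exists a universal constant $C\ge 1$ such that the following holds. Let $f:\mathbb{R}^d\to\mathbb{R}$ be $L$-smooth and satisfy the gradient-domination property $$\Vert\nabla f(x)\Vert^2\ \ge\ 2\mu\,(f(x)-f(x^* ))\qquad\forall x\in\mathbb{R}^d,$$ where $\mu>0$ and $x^*\in\arg\min_{x\in\mathbb{R}^d}f(x)$, and let $\kappa=L/\mu>1$. Suppose the algorithm AQGD (defined in the context) is run on $f$ with step-size $\alpha=1/(6L)$ and contraction factor $\gamma=\sqrt{d}/2^b$, where the bit-precision $b$ per component satisfies $$b\ \ge\ C\log\left(\frac{d\kappa}{\kappa-1}\right).$$ Then for all $t\ge 0$, $$f(x_t)-f(x^* )\ \le\ \left(1-\frac{1}{12\kappa}\right)^t\left(f(x_0)-f(x^* )+\alpha R_0^2\right).$$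
   Context: $\Vert\cdot\Vert$ is the Euclidean norm. A continuously differentiable $f:\mathbb{R}^d\to\mathbb{R}$ is $L$-smooth ($L>0$) if $\Vert\nabla f(x)-\nabla f(y)\Vert\le L\Vert x-y\Vert$ for all $x,y\in\mathbb{R}^d$. Scalar quantizer $\mathcal{Q}_{b,R}$ ($b$ a positive integer, $R\ge 0$): for $X\in\mathbb{R}^d$ with $\Vert X\Vert\le R$ (so each component $X_i\in[-R,R]$), partition $[-R,R]$ into $2^b$ bins of equal width and let $\tilde X_i$ be the center of the bin containing $X_i$; then $\mathcal{Q}_{b,R}(X)=\tilde X=[\tilde X_1,\dots,\tilde X_d]^\top$. Only the values of $\mathcal{Q}_{b,R}$ on $\{\Vert X\Vert\le R\}$ are specified. Algorithm AQGD, with step-size $\alpha>0$, contraction factor $\gamma$ and bit-precision $b$: initialize $x_0=0$, $g_{-1}=0$, and pick $R_0$ such that $\Vert\nabla f(x_0)\Vert\le R_0$. For $t=0,1,2,\dots$: $$i_t=\nabla f(x_t)-g_{t-1},\quad \tilde i_t=\mathcal{Q}_{b,R_t}(i_t),\quad g_t=g_{t-1}+\tilde i_t,\quad x_{t+1}=x_t-\alpha g_t,\quad R_{t+1}=\gamma R_t+\alpha L\Vert g_t\Vert.$$ *)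

(* Defs.v *)
From mathcomp Require Import all_boot all_order all_algebra.
From mathcomp Require Import all_classical all_reals all_analysis.

Set Implicit Arguments.
Unset Strict Implicit.
Unset Printing Implicit Defensive.

Import Order.TTheory GRing.Theory Num.Theory.
Import numFieldNormedType.Exports.

Local Open Scope classical_set_scope.
Local Open Scope ring_scope.

(* The Euclidean norm.  The library norm on ['cV[R]_d] is the sup norm: it
   generates the same topology, hence the same notions of continuity and
   differentiability, but it is not the norm wanted in the estimates. *)
Definition enorm (R : realType) (d : nat) (x : 'cV[R]_d) : R :=
  Num.sqrt (\sum_(i < d) x i 0 ^+ 2).

Definition gradient (R : realType) (d : nat) (f : 'cV[R]_d -> R)
    (x : 'cV[R]_d) : 'cV[R]_d :=
  \col_(i < d) 'D_(delta_mx i 0) f x.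

Definition continuously_differentiable (R : realType) (d : nat)
    (f : 'cV[R]_d -> R) : Prop :=
  (forall x, differentiable f x) /\ continuous (gradient f).

Definition smooth (R : realType) (d : nat) (L : R) (f : 'cV[R]_d -> R) : Prop :=
  [/\ 0 < L, continuously_differentiable f &
      forall x y, enorm (gradient f x - gradient f y) <= L * enorm (x - y)].

Definition argmin (R : realType) (d : nat) (f : 'cV[R]_d -> R) :
    set 'cV[R]_d :=
  [set xs | forall x, f xs <= f x].

Definition gradient_dominated (R : realType) (d : nat) (mu : R)
    (f : 'cV[R]_d -> R) (xs : 'cV[R]_d) : Prop :=
  forall x, 2 * mu * (f x - f xs) <= enorm (gradient f x) ^+ 2.

Section Quantizer.
Variables (R : realType) (b : nat) (r : R).

Definition bin_width : R := 2 * r / 2 ^+ b.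
Definition bin_left (k : 'I_(2 ^ b)) : R := - r + k%:R * bin_width.
Definition bin_right (k : 'I_(2 ^ b)) : R := - r + k.+1%:R * bin_width.
Definition bin_center (k : 'I_(2 ^ b)) : R := (bin_left k + bin_right k) / 2.

(* The endpoint shared by two consecutive bins may be given to either of them.
   For [r = 0] all the bins have width 0, so one of them is [{0}] and the
   others are empty; the library's [partition], which asks for nonempty
   classes, would exclude this case. *)
Definition bin_partition (B : 'I_(2 ^ b) -> set R) : Prop :=
  [/\ \bigcup_k B k = `[- r, r]%classic, trivIset setT B &
      forall k, `]bin_left k, bin_right k[%classic `<=` B k /\
                B k `<=` `[bin_left k, bin_right k]%classic].

(* [Q] is unconstrained outside of the ball of radius [r]. *)
Definition scalar_quantizer (d : nat) (Q : 'cV[R]_d -> 'cV[R]_d) : Prop :=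
  exists2 B, bin_partition B &
    forall X, enorm X <= r ->
      forall i k, B k (X i 0) -> Q X i 0 = bin_center k.

End Quantizer.

(* The state of AQGD at the beginning of iteration [t], that is
   [(x_t, g_{t-1}, R_t)]. *)
Record aqgd_state (R : realType) (d : nat) := AQGDState {
  aqgd_x : 'cV[R]_d;
  aqgd_g : 'cV[R]_d;
  aqgd_radius : R }.

Section AQGD.
Variables (R : realType) (d : nat).
Variables (Q : R -> 'cV[R]_d -> 'cV[R]_d) (f : 'cV[R]_d -> R).
Variables (L alpha gamma R0 : R).

Definition aqgd_init : aqgd_state R d := AQGDState 0 0 R0.

Definition aqgd_step (s : aqgd_state R d) : aqgd_state R d :=
  let innov := gradient f (aqgd_x s) - aqgd_g s in
  let g := aqgd_g s + Q (aqgd_radius s) innov in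
  AQGDState (aqgd_x s - alpha *: g) g
            (gamma * aqgd_radius s + alpha * L * enorm g).

Definition aqgd (t : nat) : aqgd_state R d := iter t aqgd_step aqgd_init.

End AQGD.

(* Main.v *)
Require Import Defs.
From mathcomp Require Import all_boot all_order all_algebra.
From mathcomp Require Import all_classical all_reals all_analysis.
From mathcomp Require Import ring lra.

Import Order.TTheory GRing.Theory Num.Theory.
Import numFieldNormedType.Exports.

Local Open Scope ring_scope.

(** Write G for the gradient at x_t, g for the quantized gradient g_t, and
    e = g - G for the quantization error of step t.

    The range R_t is updated so that it always dominates the innovation i_t.
    A quantizer of range r makes an error of at most r / 2^b in each
    coordinate, so |e| <= gamma R_t ([quantizer_error]), and by L-smoothness
    the gradient moves by at most alpha L |g| along a step; these are exactly
    the two terms of R_(t+1) ([aqgd_radius_bounds_innovation]).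

    Neither the gap f(x_t) - f(xs) nor R_t need decrease alone: a long step
    enlarges R_(t+1), and a large error spoils the descent.  But
      V_t = f(x_t) - f(xs) + alpha R_t^2
    contracts at every step ([aqgd_lyapunov_step]).  The descent inequality
    ([smooth_descent]), with <G, g> = (|G|^2 + |g|^2 - |e|^2) / 2 and
    alpha L = 1/6, gives
      f(x_(t+1)) <= f(x_t) - alpha/2 |G|^2 - 5 alpha/12 |g|^2 + alpha/2 |e|^2,
    and the definition of the range gives
      R_(t+1)^2 <= 2 gamma^2 R_t^2 + |g|^2 / 18.
    The negative multiple of |g|^2 in the former absorbs the positive one of
    the latter.  Gradient domination turns -alpha/2 |G|^2 into a contraction
    of the gap by 1 - alpha mu = 1 - 1/(6 kappa), and what remains is
    (5/2) gamma^2 alpha R_t^2.  As kappa > 1, the rate 1 - 1/(12 kappa) is at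
    least 11/12, so it suffices that (5/2) gamma^2 = (5/2) d / 4^b is at most
    11/12: this is where the bit-precision enters, and C = 3 is enough
    ([contraction_factor_small]).  Since V_t bounds the gap, iterating the
    contraction concludes. *)

(** * Euclidean inner product and norm *)

Definition dot {R : realType} {d : nat} (x y : 'cV[R]_d) : R :=
  \sum_(i < d) x i 0 * y i 0.

Lemma dotC {R : realType} {d : nat} (x y : 'cV[R]_d) : dot x y = dot y x.
Proof. by apply: eq_bigr => i _; rewrite mulrC. Qed.

Lemma dotDl {R : realType} {d : nat} (x y z : 'cV[R]_d) :
  dot (x + y) z = dot x z + dot y z.
Proof. by rewrite -big_split; apply: eq_bigr => i _; rewrite mxE mulrDl. Qed.

Lemma dotDr {R : realType} {d : nat} (x y z : 'cV[R]_d) :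
  dot x (y + z) = dot x y + dot x z.
Proof. by rewrite dotC dotDl !(dotC x). Qed.

Lemma dotZl {R : realType} {d : nat} (a : R) (x y : 'cV[R]_d) :
  dot (a *: x) y = a * dot x y.
Proof. by rewrite mulr_sumr; apply: eq_bigr => i _; rewrite mxE mulrA. Qed.

Lemma dotZr {R : realType} {d : nat} (a : R) (x y : 'cV[R]_d) :
  dot x (a *: y) = a * dot x y.
Proof. by rewrite dotC dotZl dotC. Qed.

Lemma enorm_ge0 {R : realType} {d : nat} (x : 'cV[R]_d) : 0 <= enorm x.
Proof. exact: sqrtr_ge0. Qed.

Lemma enorm_sqr {R : realType} {d : nat} (x : 'cV[R]_d) :
  enorm x ^+ 2 = dot x x.
Proof. by rewrite sqr_sqrtr ?sumr_ge0// => i _; exact: sqr_ge0. Qed.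

Lemma enorm_sqrD {R : realType} {d : nat} (x y : 'cV[R]_d) :
  enorm (x + y) ^+ 2 = enorm x ^+ 2 + 2 * dot x y + enorm y ^+ 2.
Proof. by rewrite !enorm_sqr !dotDl !dotDr (dotC y x); ring. Qed.

Lemma enormZ {R : realType} {d : nat} (a : R) (x : 'cV[R]_d) :
  enorm (a *: x) = `|a| * enorm x.
Proof.
rewrite /enorm -sqrtr_sqr -sqrtrM ?sqr_ge0// mulr_sumr; congr Num.sqrt.
by apply: eq_bigr => i _; rewrite mxE exprMn.
Qed.

Lemma enormN {R : realType} {d : nat} (x : 'cV[R]_d) : enorm (- x) = enorm x.
Proof. by rewrite -scaleN1r enormZ normrN1 mul1r. Qed.

Lemma ler_coord_enorm {R : realType} {d : nat} (x : 'cV[R]_d) (i : 'I_d) :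
  `|x i 0| <= enorm x.
Proof.
rewrite -sqrtr_sqr ler_wsqrtr// (bigD1 i)//= lerDl.
by apply: sumr_ge0 => j _; exact: sqr_ge0.
Qed.

Lemma enorm_eq0 {R : realType} {d : nat} (x : 'cV[R]_d) : enorm x = 0 -> x = 0.
Proof.
move=> x0; apply/matrixP => i j; rewrite ord1 mxE; apply/eqP.
by rewrite -normr_le0 -x0 ler_coord_enorm.
Qed.

(** For nonzero vectors, expand the squared norm of |y| x - |x| y, whose two
    terms have the same length |x| |y|. *)
Lemma dot_le_enorm {R : realType} {d : nat} (x y : 'cV[R]_d) :
  dot x y <= enorm x * enorm y.
Proof.
have dot0 (z : 'cV[R]_d) : dot 0 z = 0 by rewrite -(scale0r 0) dotZl mul0r.
have [/eqP/enorm_eq0->|x0] := boolP (enorm x == 0).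
  by rewrite dot0 mulr_ge0 ?enorm_ge0.
have [/eqP/enorm_eq0->|y0] := boolP (enorm y == 0).
  by rewrite dotC dot0 mulr_ge0 ?enorm_ge0.
have xy_gt0 : 0 < enorm x * enorm y.
  by rewrite mulr_gt0// lt_neqAle eq_sym enorm_ge0 andbT.
have := sqr_ge0 (enorm (enorm y *: x + - enorm x *: y)).
rewrite enorm_sqrD dotZl dotZr !enormZ normrN !ger0_norm ?enorm_ge0// => H.
rewrite -subr_ge0 -(pmulr_rge0 _ xy_gt0); nra.
Qed.

Lemma ler_enormD {R : realType} {d : nat} (x y : 'cV[R]_d) :
  enorm (x + y) <= enorm x + enorm y.
Proof.
rewrite -(ler_pXn2r (ltn0Sn 1)) ?nnegrE ?addr_ge0 ?enorm_ge0//.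
rewrite enorm_sqrD; have := dot_le_enorm x y; nra.
Qed.

Lemma enorm_le_coord {R : realType} {d : nat} (x : 'cV[R]_d) (c : R) :
  0 <= c -> (forall i, `|x i 0| <= c) -> enorm x <= Num.sqrt d%:R * c.
Proof.
move=> c0 xc; rewrite -[c in leRHS]ger0_norm// -sqrtr_sqr -sqrtrM ?ler0n//.
apply: ler_wsqrtr.
have -> : d%:R * c ^+ 2 = \sum_(i < d) c ^+ 2.
  by rewrite sumr_const card_ord mulr_natl.
apply: ler_sum => i _.
by rewrite -(real_normK (num_real (x i 0))) ler_pXn2r ?nnegrE.
Qed.

(** * The descent inequality *)

Lemma derive_gradient {R : realType} {d : nat} (f : 'cV[R]_d -> R)
    (x v : 'cV[R]_d) :
  differentiable f x -> 'D_v f x = dot (gradient f x) v.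
Proof.
move=> df; rewrite deriveE// {1}[v]matrix_sum_delta linear_sum.
apply: eq_bigr => i _; rewrite big_ord1 linearZ /= !mxE deriveE//.
by rewrite mulrC.
Qed.

(** The derivative of f along v at x + s v and that of its restriction to the
    line at s are limits of the same difference quotient. *)
Lemma is_derive_line {R : realType} {d : nat} (f : 'cV[R]_d -> R)
    (x v : 'cV[R]_d) (s : R) :
  differentiable f (x + s *: v) ->
  is_derive s 1 (fun u : R => f (x + u *: v)) (dot (gradient f (x + s *: v)) v).
Proof.
move=> df; rewrite -derive_gradient//.
have quotE : (fun h : R => h^-1 *: (f (x + (h *: (1 : R) + s) *: v) -
    f (x + s *: v))) =
  (fun h : R => h^-1 *: (f (h *: v + (x + s *: v)) - f (x + s *: v))).
  apply/funext => h; congr (_ *: (f _ - _)).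
  by rewrite scalerDl [h *: _]mulr1 addrCA.
have fv : derivable f (x + s *: v) v by exact: diff_derivable.
split; first by move: fv; rewrite /derivable -quotE.
by rewrite /derive -quotE.
Qed.

(** The mean value theorem, applied on [0, 1] to the difference phi between f
    and the quadratic upper model along the segment from x to x + v: phi' <= 0
    because the gradient at x + s v is within L s |v| of the gradient at x. *)
Lemma smooth_descent {R : realType} {d : nat} (L : R) (f : 'cV[R]_d -> R)
    (x v : 'cV[R]_d) :
  smooth L f ->
  f (x + v) <= f x + dot (gradient f x) v + L / 2 * enorm v ^+ 2.
Proof.
move=> [L0 [df _] lipf].
pose phi (s : R) := f (x + s *: v) - (dot (gradient f x) v * s +
  L / 2 * enorm v ^+ 2 * s ^+ 2).
pose dphi (s : R) := dot (gradient f (x + s *: v)) v -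
  (dot (gradient f x) v + L * enorm v ^+ 2 * s).
have phi' (s : R) : is_derive s 1 phi (dphi s).
  have ? := is_derive_line f x v s (df _).
  apply: is_derive_eq; rewrite /dphi /GRing.scale /=; lra.
have [|c /itvP c01] := @MVT_segment R phi dphi 0 1 ler01 (fun s _ => phi' s).
  by apply: derivable_within_continuous => s _; exact: ex_derive.
rewrite subr0 mulr1.
have : dphi c <= 0.
  have -> : dphi c =
      dot (gradient f (x + c *: v) - gradient f x) v - L * enorm v ^+ 2 * c.
    by rewrite dotDl -[- gradient f x]scaleN1r dotZl /dphi; ring.
  rewrite subr_le0 (le_trans (dot_le_enorm _ _))//.
  have := lipf (x + c *: v) x.
  rewrite addrAC subrr add0r enormZ ger0_norm ?c01// => H.
  have := ler_wpM2r (enorm_ge0 v) H; lra.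
rewrite /phi scale0r scale1r addr0; lra.
Qed.

(** * Quantization error and dynamic range *)

(** The center of a bin is within half a bin width, that is r / 2^b, of every
    point of the bin. *)
Lemma quantizer_error {R : realType} {d : nat} (b : nat) (r : R)
    (Q : 'cV[R]_d -> 'cV[R]_d) (X : 'cV[R]_d) :
  scalar_quantizer b r Q -> enorm X <= r ->
  enorm (Q X - X) <= Num.sqrt d%:R / 2 ^+ b * r.
Proof.
move=> [B [cvrB _ binB] QB] Xr.
have r0 : 0 <= r := le_trans (enorm_ge0 X) Xr.
have e0 : 0 < 2 ^+ b :> R by rewrite exprn_gt0.
rewrite -mulrA (mulrC _ r); apply: enorm_le_coord => [|i].
  by rewrite divr_ge0// ltW.
have : (\bigcup_k B k)%classic (X i 0).
  rewrite cvrB /= in_itv /= -ler_norml.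
  exact: le_trans (ler_coord_enorm X i) Xr.
move=> [k _ Bk]; rewrite !mxE (QB X Xr i k Bk).
have [_ /(_ _ Bk)] := binB k.
rewrite /= in_itv /= /bin_center /bin_left /bin_right /bin_width.
rewrite -(natr1 k) -(mulrA 2 r) ler_norml; set w := r / _ => /andP[h1 h2].
by apply/andP; split; lra.
Qed.

(** The next innovation is the change of the gradient along the step minus the
    current quantization error; the two terms in the update of the range bound
    these two vectors. *)
Lemma aqgd_radius_bounds_innovation {R : realType} {d : nat}
    (Q : R -> 'cV[R]_d -> 'cV[R]_d) (f : 'cV[R]_d -> R)
    (L alpha R0 : R) (b t : nat) :
  let gamma := Num.sqrt d%:R / 2 ^+ b in
  let s := aqgd Q f L alpha gamma R0 t in
  smooth L f -> 0 <= alpha ->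
  (forall r, 0 <= r -> scalar_quantizer b r (Q r)) ->
  enorm (gradient f 0) <= R0 ->
  enorm (gradient f (aqgd_x s) - aqgd_g s) <= aqgd_radius s.
Proof.
move=> gamma /= [L0 _ lipf] alpha0 HQ gradR0.
elim: t => [|t]; first by rewrite /= subr0.
rewrite /aqgd iterS -/(aqgd Q f L alpha gamma R0 t).
case: (aqgd _ _ _ _ _ _ t) => x g r /=; set i := _ - g => ir.
have r0 := le_trans (enorm_ge0 _) ir.
have err := quantizer_error _ _ _ _ (HQ r r0) ir.
set g' := g + Q r i.
have -> : gradient f (x - alpha *: g') - g' =
    (gradient f (x - alpha *: g') - gradient f x) + - (Q r i - i).
  by rewrite /g' {2}/i; apply/matrixP => j k; rewrite !mxE; ring.
rewrite (le_trans (ler_enormD _ _))// enormN addrC lerD//.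
rewrite (le_trans (lipf _ _))//.
by rewrite addrAC subrr add0r enormN enormZ ger0_norm// mulrCA mulrA.
Qed.

(** * Contraction of the Lyapunov function *)

(** The weight alpha of the squared range makes the |g|^2 terms compensate:
    the descent provides -5/12 alpha |g|^2 and the range costs 1/18 alpha
    |g|^2.  The factor 5/2 is 2, from squaring the sum that defines the new
    range, plus 1/2, from the effect of the quantization error on descent. *)
Lemma aqgd_lyapunov_step {R : realType} {d : nat}
    (Q : R -> 'cV[R]_d -> 'cV[R]_d) (f : 'cV[R]_d -> R)
    (L mu gamma : R) (xs : 'cV[R]_d) (s : aqgd_state R d) :
  let alpha := (6 * L)^-1 in
  let V := fun s => f (aqgd_x s) - f xs + alpha * aqgd_radius s ^+ 2 in
  let i := gradient f (aqgd_x s) - aqgd_g s in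
  smooth L f -> 0 < mu -> argmin f xs -> gradient_dominated mu f xs ->
  1 < L / mu ->
  5 / 2 * gamma ^+ 2 <= 11 / 12 ->
  enorm (Q (aqgd_radius s) i - i) <= gamma * aqgd_radius s ->
  V (aqgd_step Q f L alpha gamma s) <= (1 - (12 * (L / mu))^-1) * V s.
Proof.
case: s => x g r alpha V /= fsm mu0 minf gdf kappa1 gammaS.
set i := _ - g; set e := Q r i - i => er.
have L0 : 0 < L by case: fsm.
have alpha0 : 0 < alpha by rewrite invr_gt0 mulr_gt0.
have alphaL : alpha * L = 1 / 6 by rewrite /alpha; field; rewrite gt_eqF.
rewrite /V /aqgd_step /= -/i.
set g' := g + Q r i; set G := gradient f x.
have g'E : g' = G + e.
  by rewrite /g' /e /i /G; apply/matrixP => j k; rewrite !mxE; ring.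
have := smooth_descent L f x (- (alpha *: g')) fsm.
have -> : dot (gradient f x) (- (alpha *: g')) = - alpha * dot G g'.
  by rewrite -scaleNr dotZr.
rewrite enormN enormZ (ger0_norm (ltW alpha0)).
(* This identity keeps the negative |g'|^2, which the range update needs. *)
have polar : 2 * dot G g' = enorm G ^+ 2 + enorm g' ^+ 2 - enorm e ^+ 2.
  by rewrite g'E enorm_sqrD dotDr -enorm_sqr; ring.
have grad_dom := gdf x; rewrite -/G in grad_dom.
have eS : enorm e ^+ 2 <= gamma ^+ 2 * r ^+ 2.
  by rewrite -exprMn ler_pXn2r ?nnegrE ?enorm_ge0// (le_trans (enorm_ge0 _) er).
have radS : (gamma * r + alpha * L * enorm g') ^+ 2 <=
    2 * gamma ^+ 2 * r ^+ 2 + 1 / 18 * enorm g' ^+ 2.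
  rewrite alphaL; have := sqr_ge0 (gamma * r - 1 / 6 * enorm g'); nra.
set F' := f (x - _); move=> desc.
have gap0 : 0 <= f x - f xs by rewrite subr_ge0 minf.
have kappaE : (12 * (L / mu))^-1 = alpha * mu / 2.
  by rewrite /alpha; field; rewrite !gt_eqF.
have k12 : (12 * (L / mu))^-1 <= 1 / 12.
  rewrite invfM -[leRHS]mulr1 mul1r ler_pM2l ?invr_gt0//.
  by rewrite invf_le1 ?(lt_trans ltr01)// ltW.
rewrite kappaE in k12 *.
have descL : F' <= f x - alpha * dot G g' + alpha / 12 * enorm g' ^+ 2.
  have <- : L / 2 * (alpha * enorm g') ^+ 2 = alpha / 12 * enorm g' ^+ 2.
    have -> : L / 2 * (alpha * enorm g') ^+ 2 =
      (alpha * L) * (alpha / 2 * enorm g' ^+ 2) by ring.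
    by rewrite alphaL; field.
  lra.
(* Multiplying by alpha makes the conclusion linear in the monomials. *)
have := ler_wpM2l (ltW alpha0) radS.
have := ler_wpM2l (ltW alpha0) grad_dom.
have := ler_wpM2l (ltW alpha0) eS.
have gr : gamma ^+ 2 * r ^+ 2 * (5 / 2) <= (1 - alpha * mu / 2) * r ^+ 2.
  have := ler_wpM2r (sqr_ge0 r) gammaS; have := ler_wpM2r (sqr_ge0 r) k12; lra.
have := ler_wpM2l (ltW alpha0) gr.
have := mulr_ge0 (mulr_ge0 (ltW alpha0) (ltW mu0)) gap0.
have g'0 := mulr_ge0 (ltW alpha0) (sqr_ge0 (enorm g')).
have := congr1 (fun z => alpha * z) polar => /=.
lra.
Qed.

(** * Bit-precision *)

(** This is e <= 4 raised to the power b.  The bound on e comes from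
    exp(-1/2) >= 1 - 1/2. *)
Lemma expR_le_expn4 {R : realType} (b : nat) :
  expR b%:R <= (2 ^+ b) ^+ 2 :> R.
Proof.
rewrite -exprM mulnC exprM -[b%:R]mulr1 expRM_natl.
apply: lerXn2r; rewrite ?nnegrE ?expR_ge0 ?sqr_ge0//.
have half : expR (2^-1) <= 2 :> R.
  rewrite -[leRHS]invrK -[2^-1 in leLHS]opprK expRN.
  rewrite lef_pV2 ?posrE ?invr_gt0 ?expR_gt0//.
  have := @expR_ge1Dx R (- 2^-1); lra.
have -> : expR 1 = expR 2^-1 ^+ 2 :> R.
  by rewrite -expRM_natl mulfV ?pnatr_eq0.
by rewrite ler_pXn2r ?nnegrE ?expR_ge0.
Qed.

(** The claim is 4^b >= (30/11) d.  As kappa / (kappa - 1) > 1, the hypothesis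
    gives b >= 3 ln d, hence 4^b >= exp b >= d^3, which is at least 4 d as soon
    as d >= 2.  For d = 1 the logarithm may be arbitrarily close to 0, and
    b >= 1 is used instead. *)
Lemma contraction_factor_small {R : realType} (d b : nat) (kappa : R) :
  (0 < d)%N -> (0 < b)%N -> 1 < kappa ->
  3 * ln (d%:R * kappa / (kappa - 1)) <= b%:R ->
  5 / 2 * (Num.sqrt d%:R / 2 ^+ b) ^+ 2 <= 11 / 12 :> R.
Proof.
move=> d0 b0 k1 bits.
rewrite expr_div_n sqr_sqrtr ?ler0n// mulrA ler_pdivrMr ?exprn_gt0//.
have [d1|d2] : (d = 1 \/ 2 <= d)%N.
  by case: d d0 {bits} => [//|[|d]] _; [left|right].
  have : 2 <= 2 ^+ b :> R by rewrite -{1}(expr1 2) ler_weXn2l// ler1n.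
  rewrite d1.
  nra.
have dR : 2 <= d%:R :> R by rewrite ler_nat.
have dpos : 0 < d%:R :> R by rewrite ltr0n.
have lnd : 3 * ln d%:R <= b%:R :> R.
  apply: le_trans bits; rewrite ler_pM2l// ler_ln ?posrE//.
    by rewrite ler_pdivlMr ?subr_gt0// ler_pM2l// gerBl.
  by rewrite divr_gt0 ?subr_gt0// mulr_gt0// (lt_trans ltr01).
have : d%:R ^+ 3 <= (2 ^+ b) ^+ 2 :> R.
  apply: le_trans (expR_le_expn4 b).
  by rewrite -{1}(lnK (x := d%:R)) ?posrE// -expRM_natl ler_expR.
rewrite exprS => H; have : 4 * d%:R <= d%:R * d%:R ^+ 2 :> R by nra.
lra.
Qed.

Theorem theorem3p4 (R : realType) :
  exists2 C : R, 1 <= C &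
  forall (d : nat) (f : 'cV[R]_d -> R) (L mu : R) (xs : 'cV[R]_d)
         (b : nat) (Q : R -> 'cV[R]_d -> 'cV[R]_d) (R0 : R),
  let kappa := L / mu in
  let alpha := (6 * L)^-1 in
  let gamma := Num.sqrt d%:R / 2 ^+ b in
  let x := fun t => aqgd_x (aqgd Q f L alpha gamma R0 t) in
  (0 < d)%N ->
  smooth L f ->
  0 < mu ->
  argmin f xs ->
  gradient_dominated mu f xs ->
  1 < kappa ->
  (0 < b)%N ->
  (forall r : R, 0 <= r -> scalar_quantizer b r (Q r)) ->
  enorm (gradient f (x 0%N)) <= R0 ->
  C * ln (d%:R * kappa / (kappa - 1)) <= b%:R ->
  forall t : nat,
    f (x t) - f xs <=
    (1 - (12 * kappa)^-1) ^+ t * (f (x 0%N) - f xs + alpha * R0 ^+ 2).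
Proof.
exists 3; first by lra.
move=> d f L mu xs b Q R0 kappa alpha gamma x d0 fsm mu0 minf gdf k1 b0 HQ
  gradR0 bits t.
have L0 : 0 < L by case: fsm.
have alpha0 : 0 <= alpha by rewrite invr_ge0 mulr_ge0// ltW.
have gammaS := contraction_factor_small d b kappa d0 b0 k1 bits.
pose V s := f (aqgd_x s) - f xs + alpha * aqgd_radius s ^+ 2.
suff Vt : V (aqgd Q f L alpha gamma R0 t) <=
    (1 - (12 * kappa)^-1) ^+ t * V (aqgd_init d R0).
  by apply: le_trans Vt; rewrite lerDl mulr_ge0// sqr_ge0.
have rate0 : 0 <= 1 - (12 * kappa)^-1.
  by rewrite subr_ge0 invf_le1; lra.
elim: t => [|t IH]; first by rewrite expr0 mul1r.
have inv :=
  aqgd_radius_bounds_innovation Q f L alpha R0 b t fsm alpha0 HQ gradR0.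
rewrite exprS -mulrA; apply: le_trans (ler_wpM2l rate0 IH).
apply: aqgd_lyapunov_step => //.
by apply: quantizer_error => //; apply: HQ; exact: le_trans (enorm_ge0 _) inv.
Qed.
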